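(* Let $S$ and $T$ be a primitive formally dual pair in a finite abelian group $G$. Let $p$ be a prime divisor of $|G|$ and let $y\in G$ be an element of order $p$. Then $$\frac{|S|^2}{p}\Big(1-\frac{\nu_T(y)}{|T|}\Big)\quad\text{and}\quad\frac{|T|^2}{p}\Big(1-\frac{\nu_S(y)}{|S|}\Big)$$ are positive integers. In particular, if $p\nmid|S|$ then $(|S|^2,|T|)>p$, and if $p\nmid|T|$ then $(|T|^2,|S|)>p$.
   Context: $(a,b)$ denotes the greatest common divisor. For a group isomorphism $\Delta:G\to\widehat G$, $y\mapsto\chi_y$, subsets $S,T\subseteq G$ form a formally dual pair if for all $y\in G$: $|\chi_y(S)|^2=\frac{|S|^2}{|T|}\nu_T(y)$ and $|\chi_y(T)|^2=\frac{|T|^2}{|S|}\nu_S(y)$, where $\chi(A)=\sum_{a\in A}\chi(a)$ and $\nu_A(y)=|\{(a_1,a_2)\in A\times A\mid y=a_1a_2^{-1}\}|$. A subset is primitive if it is not contained in a coset of a proper subgroup and is not a union of cosets of a nontrivial subgroup; the pair is primitive if both sets are primitive. *)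

(* Defs.v *)
From HB Require Import structures.
From mathcomp Require Import all_boot all_order all_algebra all_fingroup all_solvable all_field all_character.

Set Implicit Arguments.
Unset Strict Implicit.
Unset Printing Implicit Defensive.

Import Order.TTheory GRing.Theory Num.Theory GroupScope.
Local Open Scope ring_scope.

(* chi is a group isomorphism from the abelian group G onto its dual, the group
   of linear characters under pointwise multiplication (the product of 'CF(G)).
   The values lie in algC, which contains all roots of unity. *)
Definition dual_isomorphism (gT : finGroupType) (G : {group gT})
    (chi : gT -> 'CF(G)) : Prop :=
  [/\ {in G, forall y, chi y \is a linear_char},
      {in G &, forall y z, chi (y * z)%g = chi y * chi z},
      {in G &, injective chi}
    & forall phi : 'CF(G), phi \is a linear_char ->
        exists2 y, y \in G & phi = chi y].

Definition char_sum (gT : finGroupType) (G : {group gT})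
    (phi : 'CF(G)) (A : {set gT}) : algC :=
  \sum_(a in A) phi a.

Definition nu (gT : finGroupType) (A : {set gT}) (y : gT) : nat :=
  #|[set u in setX A A | y == (u.1 * u.2^-1)%g]|.

(* When S and T are empty the quotients take the value 0; primitive sets in a
   nontrivial group are nonempty. *)
Definition formally_dual (gT : finGroupType) (G : {group gT})
    (chi : gT -> 'CF(G)) (S T : {set gT}) : Prop :=
  [/\ S \subset G, T \subset G
    & {in G, forall y,
        `|char_sum (chi y) S| ^+ 2
          = (#|S|%:R ^+ 2 / #|T|%:R) * (nu T y)%:R
        /\ `|char_sum (chi y) T| ^+ 2
          = (#|T|%:R ^+ 2 / #|S|%:R) * (nu S y)%:R}].

Definition primitive_set (gT : finGroupType) (G : {group gT})
    (A : {set gT}) : Prop :=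
  (forall H : {group gT}, H \proper G ->
     forall C : {set gT}, C \in rcosets H G -> ~ (A \subset C))
  /\ (forall H : {group gT}, H \subset G -> H :!=: 1%g ->
     forall P : {set {set gT}}, P \subset rcosets H G -> A <> cover P).

Definition positive_integer (x : rat) : Prop := x \is a Num.int /\ 0 < x.

(* Main.v *)
(* If y has order p, the values of chi_y are p-th roots of unity, so the
   Frobenius congruence gives chi_y(S)^p = |S| modulo p in the ring of algebraic
   integers; the same holds for the conjugate, hence (|chi_y(S)|^2)^p = |S|^2
   modulo p.  By formal duality |chi_y(S)|^2 is rational, hence an integer m, and
   Fermat turns the congruence into m = |S|^2 modulo p.  The quantity in the
   theorem is (|S|^2 - m) / p; it vanishes only if nu_T(y) = |T|, that is if
   y T = T, which primitivity of T excludes. *)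
Require Import Defs.
From HB Require Import structures.
From mathcomp Require Import all_boot all_order all_algebra all_fingroup all_solvable all_field all_character.

Set Implicit Arguments.
Unset Strict Implicit.
Unset Printing Implicit Defensive.

Import Order.TTheory GRing.Theory Num.Theory GroupScope.
Local Open Scope ring_scope.

(** The inner binomial coefficients are divisible by [p], and their cofactors are algebraic integers
    because [x] and [y] are. *)
Lemma eqAmod_exprD (p : nat) (x y : algC) :
  prime p -> x \in Aint -> y \in Aint ->
  ((x + y) ^+ p == x ^+ p + y ^+ p %[mod p])%A.
Proof.
move=> p_pr Ax Ay; have p_gt0 := prime_gt0 p_pr.
rewrite exprDn /eqAmod; case: p => // p in p_pr p_gt0 *.
rewrite big_ord_recl big_ord_recr /= subn0 bin0 subnn binn !expr0 mulr1 mul1r.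
rewrite !mulr1n [X in _ + X - _]addrC addrA [_ - _]addrC addKr.
apply: rpred_sum => i _.
have /dvdnP[k ->] : (p.+1 %| 'C(p.+1, bump 0 i))%N.
  by apply: prime_dvd_bin => //; rewrite /bump /= !add1n ltnS /= ltn_ord.
rewrite -eqAmod0 mulrnA -[_ *+ p.+1]mulr_natr.
by apply: eqAmodMl0; rewrite rpredMn ?rpredM ?rpredX.
Qed.

Lemma eqAmod_expr_sum (p : nat) (I : finType) (A : {set I}) (F : I -> algC) :
  prime p -> (forall i, i \in A -> F i \in Aint) ->
  ((\sum_(i in A) F i) ^+ p == \sum_(i in A) F i ^+ p %[mod p])%A.
Proof.
move=> p_pr AF.
suff [] : \sum_(i in A) F i \in Aint
    /\ ((\sum_(i in A) F i) ^+ p == \sum_(i in A) F i ^+ p %[mod p])%A by [].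
(* Integrality of the partial sum is carried along with the congruence, since [eqAmod_exprD] needs
   it at each addition. *)
pose K (u v : algC) := u \in Aint /\ (u ^+ p == v %[mod p])%A.
apply: (big_ind2 K) => [|u u' v v' [Au uu'] [Av vv']|i iA].
- by rewrite /K rpred0 expr0n eqn0Ngt prime_gt0.
- split; first exact: rpredD.
  exact: eqAmod_trans (eqAmod_exprD p_pr Au Av) (eqAmodD uu' vv').
- by split; [exact: AF | exact: eqAmod_refl].
Qed.

Lemma normC_sum_unity_mod (p m : nat) (I : finType) (A : {set I})
    (F : I -> algC) :
  prime p -> (forall i, i \in A -> F i ^+ p = 1) ->
  `|\sum_(i in A) F i| ^+ 2 = m%:R -> m = (#|A| ^ 2)%N %[mod p].
Proof.
move=> p_pr F1 normF.
have AF i : i \in A -> F i \in Aint.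
  move=> iA; apply: (@Aint_unity_root p); first exact: prime_gt0.
  exact/unity_rootP/F1.
(* A general [f] covers both uses below: the identity and complex conjugation, the two factors of
   the squared norm. *)
have sumX (f : {rmorphism algC -> algC}) :
    (f (\sum_(i in A) F i) ^+ p == #|A|%:R %[mod p])%A.
  have -> : #|A|%:R = \sum_(i in A) f (F i) ^+ p.
    rewrite -sumr_const; apply: eq_bigr => i iA.
    by rewrite -rmorphXn F1 ?rmorph1.
  by rewrite rmorph_sum; apply: eqAmod_expr_sum => // i iA; rewrite Aint_aut AF.
have ASum (f : {rmorphism algC -> algC}) : f (\sum_(i in A) F i) \in Aint.
  by rewrite Aint_aut rpred_sum // => i /AF.
rewrite -(fermat_little m p_pr); apply/eqP; rewrite -eqAmod_nat.
suff: (m%:R ^+ p == #|A|%:R ^+ 2 %[mod p])%A by rewrite -!natrX.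
rewrite -normF normCK exprMn expr2.
by apply: eqAmodM; rewrite ?rpredX ?rpred_nat ?(ASum idfun) ?(sumX idfun) ?sumX.
Qed.

(** A pair with quotient [y] is determined by its second entry [b], the first being [y * b]. *)
Lemma nuE (gT : finGroupType) (A : {set gT}) (y : gT) :
  nu A y = #|[set b in A | (y * b)%g \in A]|.
Proof.
have inj : injective (fun b : gT => ((y * b)%g, b)) by move=> b c [].
rewrite /nu -(card_imset _ inj); apply: eq_card => -[a b]; rewrite !inE /=.
apply/idP/imsetP => [/andP[/andP[aA bA] /eqP->]|[c]].
  by exists b; rewrite ?inE mulgKV ?bA.
by rewrite inE => /andP[cA ycA] [-> ->]; rewrite ycA cA mulgK eqxx.
Qed.

Lemma nu_lt_card (gT : finGroupType) (G : {group gT}) (A : {set gT}) (y : gT) :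
  A \subset G -> primitive_set G A -> y \in G -> y != 1%g ->
  (nu A y < #|A|)%N.
Proof.
move=> sAG [_ not_union] yG y1; rewrite nuE.
have sBA : [set b in A | (y * b)%g \in A] \subset A.
  by apply/subsetP => b; rewrite inE => /andP[].
rewrite ltn_neqAle subset_leq_card // andbT; apply/negP => /eqP eqAB.
have yA b : b \in A -> (y * b)%g \in A.
  have /eqP eqBA : [set b in A | (y * b)%g \in A] == A.
    by rewrite eqEcard sBA eqAB leqnn.
  by rewrite -{1}eqBA inE => /andP[].
(* Equality would make [A] stable under left multiplication by [y], hence by all of [<[y]>], so [A]
   would be the union of the cosets [<[y]> :* a] with [a] in [A]. *)
apply: (not_union <[y]>%G _ _ (rcosets <[y]> A)).
- by rewrite cycle_subG.
- by rewrite cycle_eq1.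
- by apply/subsetP => _ /rcosetsP[b bA ->]; apply/rcosetsP; exists b;
    rewrite ?(subsetP sAG).
apply/setP => a; apply/idP/bigcupP => [aA | [_ /rcosetsP[b bA ->]]].
  by exists (<[y]> :* a)%g; [apply/rcosetsP; exists a | exact: rcoset_refl].
case/rcosetP => _ /cycleP[n ->] ->.
by elim: n => [|n IHn]; rewrite ?mul1g // expgS -mulgA yA.
Qed.

(** The empty set is the union of the empty family of cosets of the nontrivial group [G]. *)
Lemma primitive_set_card_gt0 (gT : finGroupType) (G : {group gT})
    (A : {set gT}) :
  G :!=: 1%g -> primitive_set G A -> (0 < #|A|)%N.
Proof.
move=> G1 [_ not_union]; rewrite card_gt0; apply/eqP => A0.
apply: (not_union G (subxx _) G1 set0); first exact: sub0set.
by rewrite A0 /cover big_set0.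
Qed.

Lemma congruence_quotient_positive (p s t n m : nat) :
  prime p -> (0 < s)%N -> (n < t)%N -> (m * t = s ^ 2 * n)%N ->
  m = (s ^ 2)%N %[mod p] ->
  positive_integer ((s%:R ^+ 2 / p%:R) * (1 - n%:R / t%:R))
  /\ (~~ (p %| s)%N -> (p < gcdn (s ^ 2) t)%N).
Proof.
move=> p_pr s_gt0 n_lt_t mt m_mod.
have p_gt0 := prime_gt0 p_pr; have t_gt0 := leq_ltn_trans (leq0n n) n_lt_t.
have m_lt : (m < s ^ 2)%N.
  by rewrite -(ltn_pmul2r t_gt0) mt ltn_pmul2l // expn_gt0 s_gt0.
have /dvdnP[k sm] : (p %| s ^ 2 - m)%N.
  by rewrite -eqn_mod_dvd ?(ltnW m_lt) //; apply/eqP.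
have k_gt0 : (0 < k)%N by move: m_lt; rewrite -subn_gt0 sm muln_gt0 => /andP[].
have s2E : (s ^ 2 = k * p + m)%N by rewrite -sm subnK // ltnW.
have key : (s ^ 2 * (t - n) = k * (p * t))%N.
  by rewrite mulnBr -mt -mulnBl sm mulnA.
split.
  (* The value is the quotient [k] of [s ^ 2 - m] by [p]. *)
  suff -> : (s%:R ^+ 2 / p%:R) * (1 - n%:R / t%:R) = k%:R :> rat.
    by split; [rewrite rpred_nat | rewrite ltr0n].
  have tn0 : t%:R != 0 :> rat by rewrite pnatr_eq0 -lt0n.
  have pn0 : p%:R != 0 :> rat by rewrite pnatr_eq0 -lt0n.
  have -> : 1 - n%:R / t%:R = (t - n)%N%:R / t%:R :> rat.
    by rewrite natrB ?mulrBl ?divff // ltnW.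
  rewrite mulf_div -natrX -!natrM.
  by rewrite key natrM mulfK // natrM mulf_neq0.
move=> pNs.
have cop : coprime (s ^ 2) p by rewrite coprime_sym coprimeXr // prime_coprime.
set g := gcdn _ _.
have g_gt0 : (0 < g)%N by rewrite gcdn_gt0 t_gt0 orbT.
(* As [p] is coprime to [s ^ 2], [g] is also the gcd of [s ^ 2] and [p * t]. After multiplication by
   [t - n] both arguments are multiples of [p * t], the first by [key]. Hence
   [p * t <= g * (t - n) <= g * t], so [p <= g]; equality would make [p] divide [s ^ 2]. *)
have dvd_pt : (p * t %| g * (t - n))%N.
  rewrite /g -(Gauss_gcdr t cop) muln_gcdl dvdn_gcd key dvdn_mull //=.
  exact: dvdn_mulr.
have le_pt : (p * t <= g * (t - n))%N.
  by apply: dvdn_leq dvd_pt; rewrite muln_gt0 g_gt0 subn_gt0.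
rewrite ltn_neqAle; apply/andP; split.
  apply: contraNneq pNs => pg; have := dvdn_gcdl (s ^ 2) t.
  by rewrite -/g -pg Euclid_dvdX // andbT.
by rewrite -(leq_pmul2r t_gt0) (leq_trans le_pt) // leq_pmul2l // leq_subr.
Qed.

Lemma dual_isomorphism_expr_order (gT : finGroupType) (G : {group gT})
    (chi : gT -> 'CF(G)) (y x : gT) :
  dual_isomorphism chi -> y \in G -> x \in G -> chi y x ^+ #[y]%g = 1.
Proof.
case=> lin_chi chiM _ _ yG xG.
have chi1 : chi 1%g x = 1.
  (* [chi 1 x] is idempotent and nonzero, hence 1. *)
  have nz := lin_char_neq0 (lin_chi _ (group1 G)) xG.
  apply: (mulfI nz); rewrite mulr1.
  by rewrite -[in RHS](mulg1 1%g) chiM // cfunE.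
rewrite -chi1 -(expg_order y); elim: #[y]%g => [|n IHn]; first by rewrite chi1.
by rewrite expgS chiM ?groupX // cfunE exprS IHn.
Qed.

(** The squared norm is the product of an algebraic integer and its conjugate; being rational and
    nonnegative, it is a natural number. *)
Lemma char_sum_norm_nat (gT : finGroupType) (G : {group gT}) (phi : 'CF(G))
    (A : {set gT}) :
  phi \is a linear_char -> `|char_sum phi A| ^+ 2 \in Crat ->
  exists m : nat, `|char_sum phi A| ^+ 2 = m%:R.
Proof.
move=> /lin_charW Nphi Qnorm; apply/natrP; rewrite natrEint exprn_ge0 // andbT.
apply: Cint_rat_Aint => //; rewrite normCK rpredM ?Aint_aut //.
  by apply: rpred_sum => a _; exact: Aint_char.
by apply: rpred_sum => a _; exact: Aint_char.
Qed.

(** Formal duality is symmetric in [S] and [T], so the theorem follows by applying this lemma twice,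
    with the sets exchanged. *)
Lemma dual_half (gT : finGroupType) (G : {group gT}) (chi : gT -> 'CF(G))
    (S T : {set gT}) (p : nat) (y : gT) :
  dual_isomorphism chi -> S \subset G -> T \subset G ->
  primitive_set G S -> primitive_set G T ->
  prime p -> y \in G -> #[y]%g = p ->
  `|char_sum (chi y) S| ^+ 2 = (#|S|%:R ^+ 2 / #|T|%:R) * (nu T y)%:R ->
  positive_integer ((#|S|%:R ^+ 2 / p%:R) * (1 - (nu T y)%:R / #|T|%:R))
  /\ (~~ (p %| #|S|)%N -> (p < gcdn (#|S| ^ 2) #|T|)%N).
Proof.
move=> isochi sSG sTG primS primT p_pr yG oy normS.
have y1 : y != 1%g by rewrite -order_gt1 oy prime_gt1.
have G1 : G :!=: 1%g.
  by apply: contraNneq y1 => G1; move: yG; rewrite G1 => /set1P->.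
have [lin_chi _ _ _] := isochi.
have [|m mE] := char_sum_norm_nat (A := S) (lin_chi _ yG).
  by rewrite normS !(rpredM, rpredX, rpredV, rpred_nat).
have T_gt0 := primitive_set_card_gt0 G1 primT.
apply: (@congruence_quotient_positive p _ _ _ m) => //.
- exact: primitive_set_card_gt0 primS.
- exact: nu_lt_card primT yG y1.
- apply/eqP; rewrite -(eqr_nat algC) !natrM -mE normS expr2 mulrAC divfK //.
  by rewrite pnatr_eq0 -lt0n.
apply: (normC_sum_unity_mod p_pr _ mE) => a aS.
by rewrite -oy dual_isomorphism_expr_order // (subsetP sSG).
Qed.

Theorem theorem5p3 (gT : finGroupType) (G : {group gT}) (chi : gT -> 'CF(G))
    (S T : {set gT}) (p : nat) (y : gT)
    (abG : abelian G) (isochi : dual_isomorphism chi)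
    (dualST : formally_dual chi S T)
    (primS : primitive_set G S) (primT : primitive_set G T)
    (p_pr : prime p) (p_dvd : (p %| #|G|)%N)
    (yG : y \in G) (oy : #[y]%g = p) :
  [/\ positive_integer
        ((#|S|%:R ^+ 2 / p%:R) * (1 - (nu T y)%:R / #|T|%:R)),
      positive_integer
        ((#|T|%:R ^+ 2 / p%:R) * (1 - (nu S y)%:R / #|S|%:R)),
      ~~ (p %| #|S|)%N -> (p < gcdn (#|S| ^ 2) #|T|)%N
    & ~~ (p %| #|T|)%N -> (p < gcdn (#|T| ^ 2) #|S|)%N].
Proof.
case: dualST => sSG sTG /(_ y yG)[normS normT].
have [posS gcdS] := dual_half isochi sSG sTG primS primT p_pr yG oy normS.
have [posT gcdT] := dual_half isochi sTG sSG primT primS p_pr yG oy normT.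
by split.
Qed.
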